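(* For every integer $n\geq 4$, the number of Dyck paths of semilength $n$ with $L=2$ is $$|\mathcal{D}_n^2| = (n-3)M_{n-4},$$ where $M_{n-4}$ is the $(n-4)$th Motzkin number. Additionally, $|\mathcal{D}_2^2|=1$ and $|\mathcal{D}_3^2|=0$. Thus the generating function $L_2(x)=\sum_{n\ge 1}|\mathcal{D}_n^2|x^n$ is given by $$L_2(x)=x^2+x^4\left(xm(x)\right)',$$ where $m(x)$ is the generating function for the Motzkin numbers and $'$ denotes the derivative with respect to $x$.
   Context: A Dyck path of semilength $n$ is a path from $(0,0)$ to $(2n,0)$ with up steps $u=(1,1)$ and down steps $d=(1,-1)$ that does not pass below the $x$-axis; $\mathcal{D}_n$ is the set of these. For $D\in\mathcal{D}_n$ and $1\le i\le n-1$, $r_i(D)$ is the number of down steps between the $i$th and $(i+1)$st up steps of $D$, and $s_i(D)$ is the number of up steps between the $i$th and $(i+1)$st down steps of $D$. The statistic $L$ is $L(D)=\prod_{i=1}^{n-1}\binom{r_i(D)+s_i(D)}{r_i(D)}$ (empty product $=1$). $\mathcal{D}_n^k=\{D\in\mathcal{D}_n : L(D)=k\}$. A Motzkin path of length $n$ is a path from $(0,0)$ to $(n,0)$ with steps $u=(1,1)$, $d=(1,-1)$, $h=(1,0)$ that does not pass below the $x$-axis; $M_n$ is the number of Motzkin paths of length $n$ (the $n$th Motzkin number), and $m(x)=\sum_{n\ge 0}M_nx^n$. *)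

(* Defs.v *)
From HB Require Import structures.
From mathcomp Require Import all_boot all_order all_algebra.

Set Implicit Arguments.
Unset Strict Implicit.
Unset Printing Implicit Defensive.

Import GRing.Theory.
Local Open Scope ring_scope.

Variant step := Up | Down | Horiz.

Definition step_encode (s : step) : option bool :=
  match s with Up => Some true | Down => Some false | Horiz => None end.

Definition step_decode (o : option bool) : step :=
  match o with Some true => Up | Some false => Down | None => Horiz end.

Lemma step_encodeK : cancel step_encode step_decode.
Proof. by case. Qed.

HB.instance Definition _ := Finite.copy step (can_type step_encodeK).

Definition step_dy (s : step) : int :=
  match s with Up => 1 | Down => -1 | Horiz => 0 end.

Definition end_height (p : seq step) : int := \sum_(s <- p) step_dy s.

(* Every step has horizontal extent 1, so [size p] is the abscissa of the
   endpoint of [p] and [take k p] is the part of [p] up to abscissa [k]. *)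
Definition motzkin_path (p : seq step) : bool :=
  (end_height p == 0)
  && all (fun k => (0 <= end_height (take k p))%R) (iota 0 (size p).+1).

Definition dyck_path (p : seq step) : bool :=
  (Horiz \notin p) && motzkin_path p.

Local Open Scope nat_scope.

(* 0-based index in [p] of the [i]th occurrence (i >= 1) of the step [a];
   the value is [size p] when [p] has fewer than [i] such steps. *)
Definition step_pos (a : step) (p : seq step) (i : nat) : nat :=
  nth (size p) [seq k <- iota 0 (size p) | nth a p k == a] i.-1.

Definition steps_between (a b : step) (p : seq step) (i : nat) : nat :=
  count_mem b (drop (step_pos a p i).+1 (take (step_pos a p i.+1) p)).

Definition dyck_r (p : seq step) (i : nat) : nat := steps_between Up Down p i.
Definition dyck_s (p : seq step) (i : nat) : nat := steps_between Down Up p i.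

Definition dyck_L (n : nat) (p : (2 * n).-tuple step) : nat :=
  \prod_(1 <= i < n) 'C(dyck_r p i + dyck_s p i, dyck_r p i).

Definition dyck_set (n : nat) : {set (2 * n).-tuple step} :=
  [set p : (2 * n).-tuple step | dyck_path p].

Definition dyck_set_L (n k : nat) : {set (2 * n).-tuple step} :=
  [set p in dyck_set n | dyck_L p == k].

Definition motzkin (n : nat) : nat :=
  #|[set p : n.-tuple step | motzkin_path p]|.

Local Open Scope ring_scope.

(* Formal power series, given by their coefficient sequences; equality of
   series is the pointwise equality [=1]. *)
Definition fps (R : pzSemiRingType) := nat -> R.

Definition fps_monomial (R : pzSemiRingType) (k : nat) : fps R :=
  fun n => (n == k)%:R.

Definition fps_add (R : pzSemiRingType) (f g : fps R) : fps R :=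
  fun n => f n + g n.

Definition fps_mul (R : pzSemiRingType) (f g : fps R) : fps R :=
  fun n => \sum_(i < n.+1) f i * g (n - i)%N.

Definition fps_deriv (R : pzSemiRingType) (f : fps R) : fps R :=
  fun n => f n.+1 *+ n.+1.

Declare Scope fps_scope.
Delimit Scope fps_scope with fps.
Bind Scope fps_scope with fps.
Notation "f + g" := (fps_add f g) : fps_scope.
Notation "f * g" := (fps_mul f g) : fps_scope.
Notation "''X^' k" := (fps_monomial _ k) : fps_scope.
Notation "f ^`()" := (fps_deriv f) : fps_scope.

Definition motzkin_gf : fps int := fun n => (motzkin n)%:R.

Definition dyck_L_gf (k : nat) : fps int :=
  fun n => if (1 <= n)%N then #|dyck_set_L n k|%:R else 0.

(* Main.v *)
Require Import Defs.
From mathcomp Require Import all_boot all_order all_algebra.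
From mathcomp Require Import zify.

(** Write r_i and s_i for the two run statistics. Record, for every up step
but the last, whether a down step follows it, and for every down step but the
last, whether an up step follows it; this gives two bit words alpha and beta
of length n - 1, with alpha_i = (r_i > 0) and beta_i = (s_i > 0). They
determine the path ([turns_inj]), and the path stays above the axis exactly
when every prefix of beta has at least as many ones as the same prefix of
alpha ([walk_turns]). Reading (beta_i, alpha_i) = (1, 0) as an up step, (0, 1)
as a down step and equal bits as a level step, this says that the word of
pairs is a Motzkin path.

Since C(r + s, r) is 1 iff r or s vanishes and 2 iff r = s = 1, L = 2 means
that exactly one position i has alpha_i = beta_i = 1, and that
r_i = s_i = 1 there. Cutting the Motzkin word at i leaves a path w1 from
height 0 to some height h and a path w2 from h to 0, of total length n - 2,
whose level steps all stand for the pair (0, 0). If w1 has k down steps, the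
condition r_i = 1 says that up step number k of w1 is immediately followed by
another up step (for k = 0, that w1 starts with an up step), where the letter
at i counts as an up step; the condition s_i = 1 is the mirror image of this
one in w2 ([dyck_two_atE], [after_rev]).

So the paths with L = 2 are counted by the sum, over i and h, of a product of
two numbers of the same kind: the number of paths of length a from height h
to 0 in which down step number h is immediately followed by another down step
or by the end. Deleting down step number h turns these into all the paths of
length a - 1 from height h - 1 to 0 ([chainedE]). The product becomes the
number of Motzkin paths of length n - 4 that are at height h - 1 at a given
abscissa; summing over h gives M_(n-4) ([sum_pathsM]), and there are n - 3
abscissas. For h = 0 both halves must be empty, which is the exceptional path
for n = 2. *)

Set Implicit Arguments.
Unset Strict Implicit.
Unset Printing Implicit Defensive.

(** * Lattice walks and their mirror images *)

(** The final height, or [None] for a path that passes below the axis: in this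
form walks compose along concatenation ([walk_cat]). *)
Fixpoint walk (h : nat) (w : seq step) : option nat :=
  match w with
  | [::] => Some h
  | Up :: w' => walk h.+1 w'
  | Horiz :: w' => walk h w'
  | Down :: w' => if h is h'.+1 then walk h' w' else None
  end.

Lemma walk_cat h w1 w2 :
  walk h (w1 ++ w2) = obind (walk^~ w2) (walk h w1).
Proof. by elim: w1 h => [|[] w1 IH] [|h] //=. Qed.

(** A count at the type [step] itself, so that equal counts are
also syntactically equal terms for linear arithmetic. *)
Definition num (a : step) (w : seq step) : nat := count_mem a w.
Arguments num : simpl never.

Lemma num_nil a : num a [::] = 0. Proof. by []. Qed.

Lemma num_cons a s w : num a (s :: w) = (s == a) + num a w.
Proof. by []. Qed.

Lemma num_cat a w1 w2 : num a (w1 ++ w2) = num a w1 + num a w2.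
Proof. exact: count_cat. Qed.

Lemma walkP g (w : seq step) h :
  reflect ((forall t, num Down (take t w) <= g + num Up (take t w))
            /\ g + num Up w = h + num Down w)
          (walk g w == Some h).
Proof.
elim: w g => [|s w IH] g /=.
  by apply: (iffP eqP) => [[->]|[_]]; [split | rewrite !num_nil !addn0 => ->].
have tcons t : take t.+1 (s :: w) = s :: take t w by [].
case: s tcons => tcons /=.
- apply: (iffP (IH _)) => -[H E]; rewrite !num_cons /= in E *; split; try lia.
  + by case=> [|t] //; have := H t; rewrite tcons !num_cons /=; lia.
  + by move=> t; have := H t.+1; rewrite tcons !num_cons /=; lia.
- case: g => [|g].
    by apply: (iffP idP) => // -[H _]; have := H 1; rewrite tcons take0.
  apply: (iffP (IH _)) => -[H E]; rewrite !num_cons /= in E *; split; try lia.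
  + by case=> [|t] //; have := H t; rewrite tcons !num_cons /=; lia.
  + by move=> t; have := H t.+1; rewrite tcons !num_cons /=; lia.
- apply: (iffP (IH _)) => -[H E]; rewrite !num_cons /= in E *; split; try lia.
  + by case=> [|t] //; have := H t; rewrite tcons !num_cons /=; lia.
  + by move=> t; have := H t.+1; rewrite tcons !num_cons /=; lia.
Qed.

Lemma motzkin_pathE (w : seq step) : motzkin_path w = (walk 0 w == Some 0).
Proof.
have hE u : end_height u = ((num Up u)%:Z - (num Down u)%:Z)%R.
  rewrite /end_height; elim: u => [|s u IH]; first by rewrite big_nil.
  by rewrite big_cons IH !num_cons; case: s => /=; lia.
apply/andP/walkP => -[].
  move=> /eqP E /allP H; rewrite hE in E; split; last by lia.
  move=> t; case: (leqP t (size w)) => Ht.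
    by have := H t; rewrite mem_iota hE; lia.
  have := H (size w); rewrite mem_iota hE take_size take_oversize; lia.
move=> H E; split; first by rewrite hE; lia.
by apply/allP => t _; have := H t; rewrite hE; lia.
Qed.

Definition flip (s : step) : step :=
  match s with Up => Down | Down => Up | Horiz => Horiz end.

Lemma flipK : involutive flip. Proof. by case. Qed.

Definition mirror (w : seq step) : seq step := rev (map flip w).

Lemma mirrorK : involutive mirror.
Proof. by move=> w; rewrite /mirror map_rev revK mapK //; exact: flipK. Qed.

Lemma walk_mirror g h w : (walk h (mirror w) == Some g) = (walk g w == Some h).
Proof.
suff imp u x y : walk x u == Some y -> walk y (mirror u) == Some x.
  by apply/idP/idP => /imp //; rewrite mirrorK.
elim: u x => [|s u IH] x /=; first by move=> /eqP[->].
rewrite /mirror /= rev_cons -cats1 walk_cat -/(mirror u).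
by case: s => /=; [|case: x => [//|x]|] => /IH /eqP ->.
Qed.

(** * The bit that follows a given number of ones *)

Definition bits (a : step) (w : seq step) : bitseq := [seq s == a | s <- w].

Lemma count_bits a w : count id (bits a w) = num a w.
Proof. by rewrite count_map; apply: eq_count. Qed.

(** The bit right after the [k]th [true] of [u]; for [k = 0], the first bit.
Past the end it is [false]. *)
Fixpoint after (k : nat) (u : bitseq) : bool :=
  if u is b :: u' then if k is 0 then b else after (k - b) u' else false.

Lemma after_take k u v : k < count id u -> after k (u ++ v) = after k u.
Proof.
elim: u k => [|b u IH] [|k] //= H; rewrite IH //; case: b H => /=; lia.
Qed.

Lemma after_drop k u v : last true u ->
  after (count id u + k) (u ++ v) = after k v.
Proof.
elim: u k => [|b u IH] k //=; case: u IH => [|c u] IH /=.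
  by case: b => //= _; rewrite !addn0 subn1.
move=> Hl; have {}IH := IH k Hl; rewrite -{}IH.
have: 0 < count id (c :: u).
  by rewrite -has_count; apply/hasP; exists (last c u) => //; rewrite mem_last.
case: b => /=; first by rewrite -addnA add1n subn1.
by rewrite add0n; case: (_ + count id u) => // m; rewrite addSn subn0.
Qed.

Lemma after_last_false u v : after (count id u) (u ++ false :: v) = false.
Proof.
elim: u => [|b u IH] //=; case: b => /=; first by rewrite add1n subn1.
by rewrite add0n; case: (count id u) IH => // m; rewrite subn0.
Qed.

(** With [k + h] ones in [u], ones number [k] and [k + 1] of [u] are, read from
the right, ones number [h + 1] and [h], and being adjacent is symmetric. The
appended [true] plays the part of the missing one when [k] or [h] is [0]. *)
Lemma after_rev k h u : k + h = count id u ->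
  after k (rcons u true) = after h (rcons (rev u) true).
Proof.
elim: u k h => [|b u IH] [|k] h //=; first by case: h.
- move=> E; have {E}-> : h = b + count id u by lia.
  rewrite rev_cons; case: b.
    rewrite -[X in _ = after _ X]cats1.
    have -> : true + count id u = count id (rcons (rev u) true) + 0.
      by rewrite -cats1 count_cat count_rev addn0 addnC.
    by rewrite after_drop ?last_rcons.
  by rewrite -!cats1 -catA /= add0n -count_rev after_last_false.
- move=> E; rewrite rev_cons.
  have -> : after (k.+1 - b) (rcons u true) = after h (rcons (rev u) true).
    by apply: IH; case: b E => /=; lia.
  case: b E => /= E.
    by rewrite -[X in _ = after _ X]cats1 after_take // -cats1 count_cat count_rev /=; lia.
  by rewrite -!cats1 -catA !after_take ?count_rev //; lia.
Qed.

(** * Encoding a path by its turns *)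

(** One bit for each step [a] of [p]: whether the next step differs from [a].
The step [z] is taken to follow the end of [p], which makes [turns] compatible
with concatenation ([turns_cat]). *)
Fixpoint turns (a z : step) (p : seq step) : bitseq :=
  if p is x :: p' then
    (if x == a then cons (head z p' != a) else id) (turns a z p')
  else [::].

Lemma head_cat (T : Type) (z : T) s1 s2 : head z (s1 ++ s2) = head (head z s2) s1.
Proof. by case: s1. Qed.

Lemma turns_cat a z p1 p2 :
  turns a z (p1 ++ p2) = turns a (head z p2) p1 ++ turns a z p2.
Proof. by elim: p1 => //= x p1 ->; rewrite head_cat; case: eqP. Qed.

Lemma size_turns a z p : size (turns a z p) = num a p.
Proof. by elim: p => //= x p IH; rewrite num_cons -IH; case: eqP. Qed.

(** When [z] differs from [a], every maximal run of [a] ends with a turn. *)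
Lemma last_turns a z p : z != a -> last true (turns a z p).
Proof.
move=> za; elim: p => //= x p IH; case: eqP => //= _.
have := size_turns a z p; case: (turns a z p) IH => //= _.
by case: p => //= y p; rewrite num_cons; case: eqP.
Qed.

(** Turns out of up runs and turns out of down runs alternate, so their numbers
differ according to the first direction and to the one after the end. *)
Lemma count_turns a z p : a != Horiz -> z != Horiz -> Horiz \notin p ->
  count id (turns (flip a) z p) + (z == flip a) =
  count id (turns a z p) + (head z p == flip a).
Proof.
move=> aH zH; elim: p => //= x p IH; rewrite inE negb_or eq_sym => /andP[xH pH].
have {IH} := IH pH; have: head z p != Horiz.
  by case: p pH => //= y p; rewrite inE negb_or eq_sym => /andP[].
by case: a aH => // _; case: x xH => // _; case: (head z p) => //= _; lia.
Qed.

Lemma split_nth_step (a : step) (p : seq step) i : i < num a p ->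
  exists p1 p2 : seq step, p = p1 ++ a :: p2 /\ num a p1 = i.
Proof.
elim: p i => //= x p IH i; rewrite num_cons; case: eqP => [->|/eqP xa].
  case: i => [|i] Hi; first by exists [::], p.
  have [|p1 [p2 [-> <-]]] := IH i; first by lia.
  by exists (a :: p1), p2; rewrite num_cons eqxx.
move=> Hi; have [|p1 [p2 [-> <-]]] := IH i; first by lia.
by exists (x :: p1), p2; rewrite num_cons (negPf xa).
Qed.

Lemma split_run (a : step) (p : seq step) i :
  a != Horiz -> Horiz \notin p -> i.+1 < num a p ->
  exists (p1 : seq step) r (p2 : seq step),
    p = p1 ++ a :: nseq r (flip a) ++ a :: p2 /\ num a p1 = i.
Proof.
move=> aH pH Hi; have [|p1 [p2 [Ep Ei]]] := @split_nth_step a p i; first by lia.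
have [|q [p3 [Ep2 Hq]]] := @split_nth_step a p2 0.
  by move: Hi; rewrite Ep num_cat num_cons eqxx Ei; lia.
exists p1, (size q), p3; split=> //; rewrite Ep Ep2; congr (_ ++ _ :: _ ++ _).
apply/all_pred1P/allP => x xq /=.
have: x != Horiz.
  by apply: contraNneq pH => <-; rewrite Ep Ep2 !(mem_cat, inE) xq !orbT.
have: x != a.
  by apply: contraTneq xq => ->; rewrite -has_pred1 has_count -/(num a q) Hq.
by case: x {xq}; case: a aH {Hi Ep Ei Ep2 Hq}.
Qed.

Lemma step_pos_split a p1 p2 :
  step_pos a (p1 ++ a :: p2) (num a p1).+1 = size p1.
Proof.
rewrite /step_pos /= size_cat iotaD filter_cat.
rewrite (@eq_in_filter _ _ (fun k => nth a p1 k == a) (iota 0 _)); last first.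
  by move=> k; rewrite mem_iota nth_cat => /andP[_ ->].
have E : size [seq k <- iota 0 (size p1) | nth a p1 k == a] = num a p1.
  by rewrite size_filter -[p1 in RHS](mkseq_nth a) /num count_map.
by rewrite nth_cat E ltnn subnn /= nth_cat add0n ltnn subnn eqxx.
Qed.

Lemma steps_between_split a b p1 q p2 : num a q = 0 ->
  steps_between a b (p1 ++ a :: q ++ a :: p2) (num a p1).+1 = num b q.
Proof.
move=> Hq; rewrite /steps_between step_pos_split.
have -> : (num a p1).+2 = (num a (p1 ++ a :: q)).+1.
  by rewrite num_cat num_cons eqxx Hq addn0 addn1.
rewrite -cat_cons catA step_pos_split take_size_cat // -cat_rcons.
by rewrite drop_size_cat // size_rcons.
Qed.

Lemma num_nseq a r b : num a (nseq r b) = (b == a) * r.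
Proof. by rewrite /num count_nseq. Qed.

(** How the runs between consecutive steps [a] are read off the turns. The run of
opposite steps after the [i]th step [a] is nonempty iff this step is a turn.
Before that run, the steps [flip a] make up runs that are complete, so the last
of them is a turn; hence the run has length 1 iff the first bit after these
turns is again a turn. Alternation gives their number, the boolean summand
accounting for a path that starts with [flip a]. *)
Lemma steps_between_turns (a : step) (p : seq step) i :
  a != Horiz -> Horiz \notin p -> i.+1 < num a p ->
  let r := steps_between a (flip a) p i.+1 in
  (0 < r) = nth false (turns a Up p) i /\
  (0 < r -> (r == 1) =
     after (count id (take i (turns a Up p)) + (head a p == flip a))
           (turns (flip a) Up p)).
Proof.
move=> aH pH Hi; have [p1 [r [p2 [Ep <-]]]] := split_run aH pH Hi.
have fa : (flip a == a) = false by case: a aH {Hi Ep}.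
have af : (a == flip a) = false by rewrite eq_sym.
rewrite Ep steps_between_split ?num_nseq ?fa // eqxx mul1n /=.
have Ea : turns a Up (p1 ++ a :: nseq r (flip a) ++ a :: p2) =
    turns a a p1 ++ (0 < r) :: turns a Up (nseq r (flip a) ++ a :: p2).
  rewrite (turns_cat _ _ p1) /= eqxx /=; congr (_ ++ _ :: _).
  by case: r {Ep} => [|r] /=; rewrite ?eqxx ?fa.
rewrite Ea nth_cat size_turns ltnn subnn; split=> // r0.
rewrite take_size_cat ?size_turns //; case: r r0 {Ea} Ep => // r _ Ep.
have p1H : Horiz \notin p1 by apply: contra pH; rewrite Ep mem_cat => ->.
have hE : head a (p1 ++ a :: nseq r.+1 (flip a) ++ a :: p2) = head a p1.
  by rewrite head_cat.
rewrite hE -(count_turns aH aH p1H) af addn0.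
rewrite (turns_cat _ _ p1) /= af eqxx -[count _ _]addn0 after_drop.
  by case: r {Ep hE} => [|r] /=; rewrite ?eqxx ?af.
by rewrite last_turns // af.
Qed.

(** The ballot condition on turns. Prepending an up step shifts [h] and the
first bit word together, prepending a down step shifts [h] and the second one,
and in both cases the two inequalities are the same; a down step from height 0
is excluded by the instance [t = 0]. *)
Lemma walk_turns h p : Horiz \notin p -> h + num Up p = num Down p ->
  walk h p = Some 0 <->
  (forall t, t < num Up p ->
     count id (take t (turns Up Up p)) + (head Up p == Down)
     <= count id (take (t + h) (turns Down Up p))).
Proof.
elim: p h => [|x p IH] h; first by rewrite !num_nil addn0 => _ ->.
rewrite inE negb_or !num_cons => /andP[xH pH].
have hH : head Up p != Horiz.
  by case: p pH {IH} => //= y p; rewrite inE negb_or eq_sym => /andP[].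
case: x xH => // _ /= E.
  rewrite (IH h.+1) //; last by lia.
  split=> H.
    case=> [|t] //= Ht; have {H} := H t; rewrite addnS addSn.
    by case: (head Up p) hH => //= _ /(_ Ht); lia.
  move=> t Ht; have {H} := H t.+1; rewrite /= [t.+1 + h]addSnnS.
  by case: (head Up p) hH => //= _ /(_ Ht); lia.
case: h E => [|h] E.
  by split=> // /(_ 0); rewrite take0 /=; lia.
rewrite (IH h) //; last by lia.
by split=> H t Ht; have {H} := H t Ht; rewrite [t + h.+1]addnS /=;
  case: (head Up p) hH => //= _; lia.
Qed.

(** The path is rebuilt step by step: the current direction says which word
yields the next bit, and that bit says whether the direction changes. *)
Lemma turns_surj m al be : m != Horiz -> last true al -> last true be ->
  count id be = count id al + (m == Down) ->
  exists p, [/\ Horiz \notin p, head Up p = m, turns Up Up p = al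
              & turns Down Up p = be].
Proof.
have [N] := ubnP (size al + size be); elim: N m al be => // N IH m al be HN mH.
have tl b u : last true (b :: u) -> last true u by case: u.
case: m mH => // _ /=.
  case: al HN => [|a al] HN Hal Hbe Hc.
    case: be Hbe Hc {HN} => [|b be] Hbe Hc; first by exists [::].
    have : 0 < count id (b :: be).
      by rewrite -has_count; apply/hasP; exists (last b be) => //; rewrite mem_last.
    by rewrite Hc.
  have [|||||p [pH ph pU pD]] := IH (if a then Down else Up) al be => //.
  - by case: a {HN Hal Hc}.
  - exact: tl Hal.
  - by rewrite Hc /=; case: a {HN Hal Hc} => /=; lia.
  by exists (Up :: p); split=> //=; rewrite pU ph; case: a {ph Hc Hal HN}.
case: be HN => [|b be] HN Hal Hbe /= Hc; first by lia.
have [|||||p [pH ph pU pD]] := IH (if b then Up else Down) al be => //.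
- by move: HN => /=; lia.
- by case: b {HN Hbe Hc}.
- exact: tl Hbe.
- by case: b Hc {HN Hbe} => /=; lia.
by exists (Down :: p); split=> //=; rewrite pD ph; case: b {ph Hc Hbe HN}.
Qed.

Lemma turns_inj p q : Horiz \notin p -> Horiz \notin q ->
  head Up p = head Up q -> turns Up Up p = turns Up Up q ->
  turns Down Up p = turns Down Up q -> p = q.
Proof.
have hH (u : seq step) : Horiz \notin u -> head Up u != Horiz.
  by case: u => //= y u; rewrite inE negb_or eq_sym => /andP[].
elim: p q => [|x p IH] [|y q] //=.
- by move=> _ _ <-.
- by move=> _ _ ->.
rewrite !inE !negb_or => /andP[xH pH] /andP[_ qH] <- {y}.
have := hH _ pH; have := hH _ qH; have := IH q pH qH.
by case: x xH => //= _; case: (head Up p) => //; case: (head Up q) => //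
  IHq _ _ E1 E2; congr cons; apply: IHq; case: E1 => //; case: E2.
Qed.

(** * Counting walks *)

Definition nwords (n : nat) (P : pred (seq step)) : nat :=
  \sum_(w : n.-tuple step) P w.

Lemma nwords_card n (P : pred (seq step)) :
  #|[set w : n.-tuple step | P w]| = nwords n P.
Proof.
by rewrite -sum1_card big_mkcond; apply: eq_bigr => w _; rewrite inE; case: (P w).
Qed.

Lemma eq_nwords n (P Q : pred (seq step)) : P =1 Q -> nwords n P = nwords n Q.
Proof. by move=> E; apply: eq_bigr => w _; rewrite E. Qed.

Lemma nwords_pred0 n : nwords n xpred0 = 0.
Proof. by rewrite /nwords big1. Qed.

Lemma nwords0 (P : pred (seq step)) : nwords 0 P = P [::].
Proof.
rewrite /nwords (bigD1 [tuple]) //= big1 ?addn0 // => w.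
by case/eqP; exact: tuple0.
Qed.

Lemma nwordsS n (P : pred (seq step)) :
  nwords n.+1 P = nwords n (P \o cons Up) + nwords n (P \o cons Down)
               + nwords n (P \o cons Horiz).
Proof.
pose f (x : step * n.-tuple step) := [tuple of x.1 :: x.2].
have fK : bijective f.
  exists (fun w => (thead w, [tuple of behead w])) => [[s w]|w] /=.
    by congr pair; apply: val_inj.
  by rewrite [RHS]tuple_eta; apply: val_inj.
rewrite /nwords (reindex f) /=; last by apply: onW_bij.
rewrite -(pair_bigA _ (fun s w => (P (s :: tval w) : nat))) /=.
rewrite (bigD1 Up) //= (bigD1 Down) //= (bigD1 Horiz) //=.
rewrite [X in _ + (_ + (_ + X))]big1; last by case.
by rewrite addn0 addnA.
Qed.

Lemma nwords_mirror n (P : pred (seq step)) : nwords n (P \o mirror) = nwords n P.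
Proof.
pose f (w : n.-tuple step) := [tuple of rev (map flip w)].
rewrite {2}/nwords (reindex_inj (h := f)) //.
by apply: (can_inj (g := f)) => w; apply: val_inj; exact: mirrorK.
Qed.

Definition paths (h n : nat) : nat := nwords n (fun w => walk h w == Some 0).

Lemma motzkinE n : motzkin n = paths 0 n.
Proof.
by rewrite /motzkin (nwords_card _ motzkin_path); apply: eq_nwords; exact: motzkin_pathE.
Qed.

Lemma paths0 h : paths h 0 = (h == 0). Proof. exact: nwords0. Qed.

Lemma pathsS h n : paths h n.+1 =
  paths h.+1 n + (if h is h'.+1 then paths h' n else 0) + paths h n.
Proof.
rewrite {1}/paths nwordsS; congr (_ + _ + _).
by case: h => //; exact: nwords_pred0.
Qed.

Lemma paths_small h n : n < h -> paths h n = 0.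
Proof.
elim: n h => [|n IH] [|h] // Hn; first by rewrite paths0.
by rewrite pathsS !IH //; lia.
Qed.

(** The one-step transfer matrix of Motzkin paths is symmetric. The bound [K]
must exceed the heights that are reached, so that truncating the matrix
discards only zero terms. *)
Lemma paths_adjoint K a b : a < K -> b < K ->
  \sum_(h < K) paths h a.+1 * paths h b = \sum_(h < K) paths h a * paths h b.+1.
Proof.
case: K => // K aK bK.
have shift c d : c < K.+1 -> \sum_(h < K.+1) paths h.+1 c * paths h d =
    \sum_(h < K.+1) paths h c * (if val h is h'.+1 then paths h' d else 0).
  move=> cK; rewrite big_ord_recr /= paths_small // mul0n addn0.
  by rewrite [RHS]big_ord_recl muln0 add0n.
pose dn c (h : nat) := if h is h'.+1 then paths h' c else 0.
have E c d : \sum_(h < K.+1) paths h c.+1 * paths h d =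
    \sum_(h < K.+1) paths h.+1 c * paths h d
    + \sum_(h < K.+1) dn c h * paths h d + \sum_(h < K.+1) paths h c * paths h d.
  by rewrite -!big_split; apply: eq_bigr => h _; rewrite pathsS !mulnDl.
under [RHS]eq_bigr => h _ do rewrite mulnC.
rewrite !E !shift // [X in X + _ = _]addnC; congr (_ + _ + _);
  by apply: eq_bigr => h _; rewrite mulnC.
Qed.

Lemma sum_pathsM K a b : a + b < K ->
  \sum_(h < K) paths h a * paths h b = paths 0 (a + b).
Proof.
elim: a b => [|a IH] b abK; last first.
  by rewrite paths_adjoint ?IH ?addnS ?addSn //; lia.
case: K abK => // K _; rewrite big_ord_recl paths0 mul1n big1 ?addn0 // => h _.
by rewrite paths0.
Qed.

(** Walks from height [h] down to 0 in which down step number [k + 1] directly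
follows down step number [k] among the letters; the end of the walk counts as
a down step, and for [k = 0] the first letter must be a down step. *)
Definition chained (k h n : nat) : nat :=
  nwords n (fun w => (walk h w == Some 0) && after k (rcons (bits Down w) true)).

Lemma chained0 k h : chained k h 0 = (h == 0) && (k == 0).
Proof. by rewrite /chained nwords0 /=; case: k. Qed.

Lemma chained0S h n :
  chained 0 h n.+1 = if h is h'.+1 then paths h' n else 0.
Proof.
rewrite /chained nwordsS.
have E (P : pred (seq step)) : P =1 xpred0 -> nwords n P = 0.
  by move=> /eq_nwords ->; exact: nwords_pred0.
rewrite E; last by move=> w /=; rewrite andbF.
rewrite add0n [X in _ + X]E ?addn0; last by move=> w /=; rewrite andbF.
by case: h => [|h]; [exact: nwords_pred0 | apply: eq_nwords => w /=; rewrite andbT].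
Qed.

Lemma chainedSS k h n : chained k.+1 h n.+1 =
  chained k.+1 h.+1 n + (if h is h'.+1 then chained k h' n else 0)
  + chained k.+1 h n.
Proof.
rewrite {1}/chained nwordsS; congr (_ + _ + _).
case: h => [|h]; first exact: nwords_pred0.
by apply: eq_nwords => w /=; rewrite subn1.
Qed.

(** Bijectively: down step number [k] (the first letter, for [k = 0]) is deleted
and the part of the walk before it is lowered by 1. That part is empty or has
fewer than [k <= h.+1] down steps, so it stays above height 0 and can be
lowered. The instances used later have [k = h.+1], but reading a first letter may change [h]
without [k]; for all [k <= h.+1] together, both sides satisfy the recurrence
[pathsS]. *)
Lemma chainedE k h n : k <= h.+1 -> chained k h.+1 n.+1 = paths h n.
Proof.
elim: n k h => [|n IH] [|k] h kh; rewrite ?chained0S //.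
  rewrite chainedSS !chained0 paths0 /=; case: h kh => [|h] /=; lia.
rewrite chainedSS !IH //; last by lia.
rewrite pathsS; congr (_ + _ + _).
case: h kh => [|h] kh; last by rewrite IH.
have -> : k = 0 by lia.
by rewrite chained0S.
Qed.

Lemma sum_chained K a b : (a.+1 + b.+1) <= K ->
  \sum_(h < K) chained h h a.+1 * chained h h b.+1 = paths 0 (a + b).
Proof.
case: K => // K abK; rewrite big_ord_recl chained0S add0n.
under eq_bigr => h _ do rewrite !lift0 !chainedE //.
by rewrite sum_pathsM //; lia.
Qed.

Lemma sum_chained0 K b : \sum_(h < K.+1) chained h h 0 * chained h h b = (b == 0).
Proof.
rewrite big_ord_recl big1 ?addn0 => [|h _]; last by rewrite lift0 chained0.
by rewrite chained0 mul1n; case: b => [|b]; rewrite ?chained0 ?chained0S.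
Qed.

(** * Products of binomial coefficients equal to 2 *)

Lemma bin_eq1 r s : ('C(r + s, r) == 1) = (r == 0) || (s == 0).
Proof.
case: r => [|r]; first by rewrite bin0.
case: s => [|s]; first by rewrite addn0 binn.
rewrite addSn binS.
have : 0 < 'C(r + s.+1, r.+1) by rewrite bin_gt0; lia.
have : 0 < 'C(r + s.+1, r) by rewrite bin_gt0; lia.
by move=> /=; case: eqP => //; lia.
Qed.

Lemma bin_eq2 r s : ('C(r + s, r) == 2) = (r == 1) && (s == 1).
Proof.
case: r => [|r]; first by rewrite bin0.
case: s => [|s]; first by rewrite addn0 binn andbF.
rewrite addSn binS.
have E1 := bin_eq1 r s.+1; have E2 := bin_eq1 r.+1 s.
rewrite addSnnS in E2.
have : 0 < 'C(r + s.+1, r.+1) by rewrite bin_gt0; lia.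
have : 0 < 'C(r + s.+1, r) by rewrite bin_gt0; lia.
move: E1 E2; rewrite /= !eqSS orbF; lia.
Qed.

Lemma prod_eq2 m (F : 'I_m -> nat) :
  (\prod_i F i == 2 : nat) =
  \sum_a [forall k, F k == if k == a then 2 else 1].
Proof.
have spec a : [forall k, F k == if k == a then 2 else 1] -> \prod_i F i = 2.
  move=> /forallP H; rewrite (bigD1 a) //= big1 ?muln1.
    by have /eqP := H a; rewrite eqxx.
  by move=> k /negPf ka; have /eqP := H k; rewrite ka.
have [F2|F2] := eqVneq (\prod_i F i) 2; last first.
  by rewrite big1 // => a _; apply/eqP; rewrite eqb0; apply: contra F2 => /spec ->.
(* A factor other than 1 divides the prime 2; the others then multiply to 1. *)
have [a Fa] : exists a, F a != 1.
  apply/existsP; apply: contraTT isT => /existsPn H; move: F2.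
  by rewrite big1 // => k _; apply/eqP; rewrite -[_ == _]negbK H.
have Fa2 : F a = 2.
  have : F a %| 2 by rewrite -F2 (bigD1 a) //= dvdn_mulr.
  by rewrite dvdn_divisors // !inE (negPf Fa) => /eqP.
have F1 : \prod_(i | i != a) F i = 1.
  by move: F2; rewrite (bigD1 a) //= Fa2; lia.
have Fk k : k != a -> F k = 1.
  by move=> ka; apply/eqP; rewrite -dvdn1 -F1 (bigD1 k) //= dvdn_mulr.
rewrite (bigD1 a) //= big1 ?addn0.
  apply/esym/eqP; rewrite eqb1; apply/forallP => k.
  by case: (eqVneq k a) => [->|/Fk ->]; rewrite ?Fa2.
move=> b ba; apply/eqP; rewrite eqb0; apply/negP => /forallP/(_ b).
by rewrite eqxx Fk.
Qed.

(** * The two halves of the word of a Dyck path with L = 2 *)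

(** The bits, for the step [x], of the word [w1 X w2 X], where the letter [X]
carries both bits. The first [X] marks the position where both statistics are
nonzero; the last one stands for the final up step and the final down step,
which are turns by convention. *)
Definition marked_bits (x : step) (w1 w2 : seq step) : bitseq :=
  bits x w1 ++ true :: rcons (bits x w2) true.

Lemma size_marked_bits x w1 w2 : size (marked_bits x w1 w2) = (size w1 + size w2).+2.
Proof. by rewrite size_cat /= size_rcons !size_map addnS addnS. Qed.

Lemma count_take_bits x (w : seq step) t : count id (take t (bits x w)) = num x (take t w).
Proof. by rewrite -map_take count_bits. Qed.

Lemma count_take_marked_bits x w1 w2 t : x != Horiz -> t <= (size w1 + size w2).+1 ->
  count id (take t (marked_bits x w1 w2)) =
  num x (take t (w1 ++ Horiz :: w2)) + (size w1 < t).
Proof.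
move=> xH Ht; rewrite /marked_bits !take_cat size_map.
case: (ltngtP t (size w1)) => tw; rewrite ?count_take_bits ?addn0 //.
  case E : (t - size w1) => [|u]; first by lia.
  have Hu : u <= size w2 by lia.
  rewrite /= count_cat count_bits num_cat num_cons eq_sym (negPf xH) /=.
  by rewrite -cats1 takel_cat ?size_map // count_take_bits; lia.
by rewrite tw subnn /= !cats0 count_bits.
Qed.

Lemma nth_marked_bits x w1 w2 k : x != Horiz -> k <= size w1 + size w2 ->
  nth false (marked_bits x w1 w2) k =
  (k == size w1) || (nth Horiz (w1 ++ Horiz :: w2) k == x).
Proof.
move=> xH Hk; rewrite /marked_bits !nth_cat size_map.
case: (ltngtP k (size w1)) => kw /=; first by rewrite (nth_map Horiz).
  case E : (k - size w1) => [|u] /=; first by lia.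
  have Hu : u < size w2 by lia.
  by rewrite nth_rcons size_map Hu (nth_map Horiz).
by rewrite kw subnn.
Qed.

(** The conditions on [(w1, w2)] that make position [size w1] contribute the
factor 2. Each appended [true] is the bit of the [X] that follows the half. *)
Definition valid_halves (w1 w2 : seq step) : bool :=
  if walk 0 w1 is Some h then
    [&& walk h w2 == Some 0, after (num Down w1) (rcons (bits Up w1) true)
      & after h (rcons (bits Down w2) true)]
  else false.

Definition two_at n (p : seq step) (a : nat) : bool :=
  [forall k : 'I_n.-1, 'C(dyck_r p k.+1 + dyck_s p k.+1, dyck_r p k.+1)
     == if val k == a then 2 else 1].

Lemma size_num (p : seq step) : Horiz \notin p -> size p = num Up p + num Down p.
Proof.
elim: p => //= x q IH; rewrite inE negb_or !num_cons => /andP[xH /IH ->].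
by case: x xH => //= _; lia.
Qed.

Definition encodes (p w1 w2 : seq step) : Prop :=
  [/\ Horiz \notin p, head Up p = Up,
      turns Up Up p = marked_bits Down w1 w2 & turns Down Up p = marked_bits Up w1 w2].

Lemma encodes_num p w1 w2 : encodes p w1 w2 ->
  num Up p = (size w1 + size w2).+2 /\ num Down p = (size w1 + size w2).+2.
Proof.
move=> [_ _ pU pD].
by rewrite -(size_turns Up Up p) -(size_turns Down Up p) pU pD !size_marked_bits.
Qed.

Lemma encodes_size p w1 w2 :
  encodes p w1 w2 -> size p = 2 * (size w1 + size w2).+2.
Proof.
move=> pE; have [pH _ _ _] := pE; have [numU numD] := encodes_num pE.
by rewrite size_num // numU numD mul2n addnn.
Qed.

Lemma dyck_pathE p w1 w2 : encodes p w1 w2 ->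
  dyck_path p = (walk 0 (w1 ++ w2) == Some 0).
Proof.
move=> pE; have [pH ph pU pD] := pE; have [numU numD] := encodes_num pE.
set n := (size w1 + size w2).+2 in numU numD.
rewrite /dyck_path pH motzkin_pathE.
have -> : walk 0 (w1 ++ w2) = walk 0 (w1 ++ Horiz :: w2) by rewrite !walk_cat.
have hW := @walk_turns 0 p pH; rewrite numU numD ph pU pD in hW.
have {}hW := hW erefl.
have cnt_eq : num Up (w1 ++ Horiz :: w2) = num Down (w1 ++ Horiz :: w2).
  have := @count_turns Up Up p isT isT pH; rewrite /= ph pU pD.
  rewrite /marked_bits !count_cat /= -!cats1 !count_cat !count_bits !num_cat !num_cons /=.
  by lia.
apply/eqP/walkP; rewrite hW.
  move=> H; split; last by lia.
  move=> t; case: (ltnP t n) => Ht.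
    by have := H t Ht; rewrite !addn0 !count_take_marked_bits //; lia.
  by rewrite !take_oversize ?size_cat /= ?cnt_eq //; rewrite /n in Ht; lia.
move=> [H _] t Ht; rewrite !addn0 !count_take_marked_bits // leq_add2r; exact: H.
Qed.

(** By [after_take] and [after_drop], the bits that decide whether the two runs
have length 1 lie inside [w1] and [w2] respectively, or on the [X] that follows
them. At any other position at most one of the two runs is nonempty. *)
Lemma dyck_two_atE p w1 w2 :
  encodes p w1 w2 -> walk 0 (w1 ++ w2) = Some 0 ->
  two_at (size w1 + size w2).+2 p (size w1) = valid_halves w1 w2.
Proof.
move=> pE; have [pH ph pU pD] := pE; have [numU numD] := encodes_num pE.
set n := (size w1 + size w2).+2 in numU numD *.
rewrite walk_cat /valid_halves; case E : (walk 0 w1) => [h|] //= ->; rewrite eqxx /=.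
have {E} /eqP/walkP[_] := E; rewrite add0n => Eh.
have rP k : k.+1 < n ->
    (0 < dyck_r p k.+1) = nth false (marked_bits Down w1 w2) k /\
    (0 < dyck_r p k.+1 -> (dyck_r p k.+1 == 1) =
       after (count id (take k (marked_bits Down w1 w2))) (marked_bits Up w1 w2)).
  rewrite -numU => kp; have := @steps_between_turns Up p k isT pH kp.
  by rewrite /= ph addn0 pU pD.
have sP k : k.+1 < n ->
    (0 < dyck_s p k.+1) = nth false (marked_bits Up w1 w2) k /\
    (0 < dyck_s p k.+1 -> (dyck_s p k.+1 == 1) =
       after (count id (take k (marked_bits Up w1 w2))).+1 (marked_bits Down w1 w2)).
  have hD : head Down p = Up by case: (p) ph numU => [|x q] //= ->.
  rewrite -numD => kp; have := @steps_between_turns Down p k isT pH kp.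
  by rewrite /= hD addn1 pU pD.
have an : (size w1).+1 < n by rewrite /n; lia.
have take_a x : take (size w1) (marked_bits x w1 w2) = bits x w1.
  by rewrite take_size_cat // size_map.
have Ea : ('C(dyck_r p (size w1).+1 + dyck_s p (size w1).+1,
              dyck_r p (size w1).+1) == 2)
    = after (num Down w1) (rcons (bits Up w1) true)
      && after h (rcons (bits Down w2) true).
  have [r0 r1] := rP _ an; have [s0 s1] := sP _ an.
  rewrite !nth_marked_bits ?leq_addr // eqxx /= in r0 s0.
  rewrite bin_eq2 r1 // s1 // !take_a !count_bits /marked_bits -!cat_rcons.
  rewrite after_take; last by rewrite -cats1 count_cat count_bits /=; lia.
  (* [w1] climbs by [h], so [h] more ones are to be read in the second half. *)
  have -> : (num Up w1).+1 = count id (rcons (bits Down w1) true) + h.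
    by rewrite -cats1 count_cat count_bits /=; lia.
  by rewrite after_drop ?last_rcons.
have an' : size w1 < n.-1 by rewrite /n; lia.
rewrite -Ea; apply/forallP/idP => [/(_ (Ordinal an'))|H k] /=; first by rewrite eqxx.
case: (eqVneq (k : nat) (size w1)) => [-> //|ka].
have kn : k.+1 < n by have := ltn_ord k; rewrite /n; lia.
have [r0 _] := rP _ kn; have [s0 _] := sP _ kn.
rewrite !nth_marked_bits // (negPf ka) /= in r0 s0; try by rewrite /n in kn; lia.
by rewrite bin_eq1 !eqn0Ngt r0 s0; case: (nth _ _ _).
Qed.

(** * Dyck paths as pairs of walks *)

Lemma dyck_pathP (p : seq step) n : dyck_path p -> size p = 2 * n ->
  [/\ Horiz \notin p, head Up p = Up, num Up p = n & num Down p = n].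
Proof.
rewrite /dyck_path motzkin_pathE => /andP[pH pw] ps.
have /walkP[_ E] := pw; have S := size_num pH.
split=> //; [|by lia..].
by case: p pH pw {ps E S} => [|[]].
Qed.

(** A walk that ends at height 0 does not end with an up step, so a down step
comes after its last up step. *)
Lemma last_turns_up h (p : seq step) : walk h p = Some 0 -> last true (turns Up Up p).
Proof.
elim: p h => //= x p IH h; case: x => /=; last exact: IH; last first.
  by case: h => // h; exact: IH.
move=> pw; have := size_turns Up Up p.
case E : (turns Up Up p) (IH _ pw) => //= _; move: pw.
by case: p {IH E} => //= y p _; rewrite num_cons; case: y.
Qed.

(** The pair [(true, true)] has no step of its own; [lettersK] excludes it. *)
Definition letters (be al : bitseq) : seq step :=
  [seq (if x.1 then if x.2 then Horiz else Up
        else if x.2 then Down else Horiz) | x <- zip be al].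

Lemma bitsK (w : seq step) : letters (bits Up w) (bits Down w) = w.
Proof. by elim: w => //= -[] w; rewrite /letters /= => ->. Qed.

Lemma lettersK be al : size be = size al ->
  (forall k, k < size be -> ~~ (nth false be k && nth false al k)) ->
  bits Up (letters be al) = be /\ bits Down (letters be al) = al.
Proof.
elim: be al => [|b be IH] [|a al] //= [S] H.
have [k /(H k.+1) //|E1 E2] := IH al S.
rewrite /letters /= -/(letters be al) E1 E2.
by have := H 0 isT; case: a b {H} => -[].
Qed.

Lemma split_marked_bits a b (u : bitseq) : size u = (a + b).+2 -> nth false u a ->
  last true u -> u = take a u ++ true :: rcons (take b (drop a.+1 u)) true.
Proof.
move=> S ua; rewrite -{1 2}(cat_take_drop a u) (drop_nth false) ?ua; last by lia.
have : size (drop a.+1 u) = b.+1 by rewrite size_drop; lia.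
case/lastP: (drop a.+1 u) => [//|v c]; rewrite size_rcons => -[<-].
rewrite last_cat /= last_rcons => ->; congr (_ ++ _ :: _).
by rewrite -cats1 take_size_cat // cats1.
Qed.

Lemma two_at_marked_bits a b (p : seq step) : dyck_path p -> size p = 2 * (a + b).+2 ->
  two_at (a + b).+2 p a ->
  exists w1 w2, [/\ size w1 = a, size w2 = b,
    turns Up Up p = marked_bits Down w1 w2 & turns Down Up p = marked_bits Up w1 w2].
Proof.
move=> pd ps /forallP H; have [pH ph pU pD] := dyck_pathP pd ps.
set al := turns Up Up p; set be := turns Down Up p.
have Sal : size al = (a + b).+2 by rewrite size_turns.
have Sbe : size be = (a + b).+2 by rewrite size_turns.
have rs k : k < (a + b).+1 -> 'C(dyck_r p k.+1 + dyck_s p k.+1, dyck_r p k.+1)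
     == (if k == a then 2 else 1).
  by move=> Hk; exact: (H (Ordinal Hk)).
have rE k : k < (a + b).+1 -> (0 < dyck_r p k.+1) = nth false al k.
  by rewrite -ltnS -pU => /(@steps_between_turns Up p k isT pH)[].
have sE k : k < (a + b).+1 -> (0 < dyck_s p k.+1) = nth false be k.
  by rewrite -ltnS -pD => /(@steps_between_turns Down p k isT pH)[].
have aab : a < (a + b).+1 by lia.
have [ala bea] : nth false al a /\ nth false be a.
  have := rs a aab; rewrite eqxx bin_eq2 -rE // -sE //.
  by move=> /andP[/eqP-> /eqP->].
have dis k : k < (a + b).+1 -> k != a -> ~~ (nth false be k && nth false al k).
  move=> Hk ka; have := rs k Hk; rewrite (negPf ka) bin_eq1 -rE // -sE //.
  by case/orP=> /eqP ->; rewrite ?andbF.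
have [||E1 E2] := @lettersK (take a be) (take a al).
- by rewrite !size_take Sal Sbe.
- move=> k; rewrite size_take Sbe => Hk.
  have {}Hk : k < a by move: Hk; case: ifP; lia.
  by rewrite !nth_take //; apply: dis; lia.
have [||E3 E4] := @lettersK (take b (drop a.+1 be)) (take b (drop a.+1 al)).
- by rewrite !size_take !size_drop Sal Sbe.
- move=> k; rewrite size_take size_drop Sbe => Hk.
  have {}Hk : k < b by move: Hk; case: ifP; lia.
  by rewrite !nth_take // !nth_drop; apply: dis; lia.
exists (letters (take a be) (take a al)).
exists (letters (take b (drop a.+1 be)) (take b (drop a.+1 al))); split.
- by rewrite size_map size_zip !size_take Sal Sbe; case: ifP; lia.
- by rewrite size_map size_zip !size_take !size_drop Sal Sbe; case: ifP; lia.
- rewrite /marked_bits E2 E4; apply: split_marked_bits => //.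
  by move: pd => /andP[_]; rewrite motzkin_pathE => /eqP; exact: last_turns_up.
- by rewrite /marked_bits E1 E3; apply: split_marked_bits => //; exact: last_turns.
Qed.

Lemma marked_bits_two_at (w1 w2 : seq step) : valid_halves w1 w2 ->
  let n := (size w1 + size w2).+2 in
  exists p, [/\ dyck_path p && two_at n p (size w1), size p = 2 * n,
    turns Up Up p = marked_bits Down w1 w2 & turns Down Up p = marked_bits Up w1 w2].
Proof.
move=> cw n.
have ww : walk 0 (w1 ++ w2) = Some 0.
  by move: cw; rewrite /valid_halves walk_cat; case: (walk 0 w1) => //= h /and3P[/eqP].
have lastj x : last true (marked_bits x w1 w2) by rewrite last_cat /= last_rcons.
have [||||p [pH ph pU pD]] :=
  @turns_surj Up (marked_bits Down w1 w2) (marked_bits Up w1 w2) => //.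
  have /eqP/walkP[_] := ww; rewrite !num_cat.
  by rewrite /marked_bits !count_cat /= -!cats1 !count_cat !count_bits /=; lia.
have pE : encodes p w1 w2 by [].
by exists p; rewrite (dyck_pathE pE) ww eqxx dyck_two_atE // (encodes_size pE).
Qed.

(** The pairs are classified by the height [h] at which the two walks meet.
Mirrored, the first one is a walk from [h] to 0 subject to the same condition
as the second one ([after_rev]). *)
Lemma card_valid_halves a b K : a + b < K ->
  #|[set w : a.-tuple step * b.-tuple step | valid_halves w.1 w.2]| =
  \sum_(h < K) chained h h a * chained h h b.
Proof.
move=> abK.
pose X h w := (walk 0 w == Some h) && after (num Down w) (rcons (bits Up w) true).
pose Y h w := (walk h w == Some 0) && after h (rcons (bits Down w) true).
have XE h : chained h h a = nwords a (X h).
  rewrite -nwords_mirror; apply: eq_nwords => w; rewrite /X /= walk_mirror.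
  case: (altP (walkP _ _ _)) => //= -[_ E].
  have nD : num Down (mirror w) = num Up w.
    by rewrite /num count_rev count_map; apply: eq_count => -[].
  have bU : bits Up (mirror w) = rev (bits Down w).
    by rewrite /bits /mirror map_rev -map_comp; congr rev; apply: eq_map => -[].
  by rewrite nD bU; apply: after_rev; rewrite count_bits.
have validE w1 w2 : size w1 = a -> (valid_halves w1 w2 : nat) = \sum_(h < K) X h w1 * Y h w2.
  move=> S1; rewrite /valid_halves /X /Y; case E : (walk 0 w1) => [h|]; last by rewrite big1.
  have hK : h < K.
    have /eqP/walkP[_ Eh] := E; have := count_size (pred1 Up) w1.
    by rewrite -/(num Up w1) S1; lia.
  rewrite (bigD1 (Ordinal hK)) //= eqxx big1 ?addn0 => [|k kh] /=.
    by rewrite mulnb andbCA.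
  case: eqP => // -[hk]; case/eqP: kh; exact: val_inj.
rewrite -sum1_card big_mkcond /=.
rewrite (eq_bigr (fun w : a.-tuple step * b.-tuple step =>
  \sum_(h < K) X h w.1 * Y h w.2)); last first.
  by move=> w _; rewrite inE -validE ?size_tuple //; case: valid_halves.
rewrite exchange_big; apply: eq_bigr => h _.
rewrite XE -(pair_bigA _ (fun w1 w2 => X h (tval w1) * Y h (tval w2))) /=.
rewrite /nwords big_distrl; apply: eq_bigr => w1 _.
by rewrite /chained /nwords big_distrr.
Qed.

Definition two_at_set n a : {set (2 * n).-tuple step} :=
  [set p : (2 * n).-tuple step | dyck_path p && two_at n p a].

Lemma card_two_at_set n a b : n = (a + b).+2 ->
  #|two_at_set n a| = \sum_(h < n) chained h h a * chained h h b.
Proof.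
move=> ->{n}; rewrite -(@card_valid_halves a b _ (ltnW (leqnn _))).
(* On the paths considered the words have sizes [a] and [b], so the default
   values of [insubd] never occur. *)
pose f (p : (2 * (a + b).+2).-tuple step) :=
  let al := turns Up Up p in let be := turns Down Up p in
  (insubd (nseq_tuple a Horiz) (letters (take a be) (take a al)),
   insubd (nseq_tuple b Horiz)
     (letters (take b (drop a.+1 be)) (take b (drop a.+1 al)))).
have fE (p : (2 * (a + b).+2).-tuple step) (w1 : a.-tuple step) (w2 : b.-tuple step) :
    turns Up Up p = marked_bits Down w1 w2 -> turns Down Up p = marked_bits Up w1 w2 ->
    f p = (w1, w2).
  move=> Ep1 Ep2; rewrite /f Ep1 Ep2.
  have t1 x : take a (marked_bits x w1 w2) = bits x w1.
    by rewrite take_size_cat // size_map size_tuple.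
  have t2 x : take b (drop a.+1 (marked_bits x w1 w2)) = bits x w2.
    rewrite /marked_bits -cat_rcons drop_size_cat ?size_rcons ?size_map ?size_tuple //.
    by rewrite -cats1 take_size_cat // size_map size_tuple.
  by rewrite !t1 !t2 !bitsK; congr pair; apply: val_inj;
    rewrite /= val_insubd size_tuple eqxx.
have ex (p : (2 * (a + b).+2).-tuple step) :
    p \in two_at_set (a + b).+2 a -> exists w1 : a.-tuple step,
    exists w2 : b.-tuple step,
    [/\ f p = (w1, w2), turns Up Up p = marked_bits Down w1 w2
      & turns Down Up p = marked_bits Up w1 w2].
  rewrite inE => /andP[pd psp].
  have [w1 [w2 [S1 S2 E1 E2]]] := two_at_marked_bits pd (size_tuple p) psp.
  move/eqP: S1 => S1; move/eqP: S2 => S2.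
  by exists (Tuple S1), (Tuple S2); rewrite (fE _ (Tuple S1) (Tuple S2)).
rewrite -(@card_in_imset _ _ f).
  apply: eq_card => -[w1 w2]; apply/imsetP/idP.
    move=> [p pS]; have [v1 [v2 [-> E1 E2]]] := ex p pS => -[-> ->].
    move: pS; rewrite !inE /= => /andP[pd psp].
    have [pH ph _ _] := dyck_pathP pd (size_tuple p).
    have pE : encodes p v1 v2 by [].
    rewrite -(dyck_two_atE pE) ?size_tuple //.
    by apply/eqP; rewrite -(dyck_pathE pE).
  rewrite inE /= => /marked_bits_two_at; rewrite !size_tuple.
  move=> [p [pS /eqP Sp E1 E2]]; exists (Tuple Sp); first by rewrite inE.
  by rewrite (fE _ w1 w2).
move=> p q pS qS; have [v1 [v2 [-> E1 E2]]] := ex p pS.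
have [u1 [u2 [-> F1 F2]]] := ex q qS => -[Ev1 Ev2].
move: pS qS; rewrite !inE => /andP[pd _] /andP[qd _].
have [pH ph _ _] := dyck_pathP pd (size_tuple p).
have [qH qh _ _] := dyck_pathP qd (size_tuple q).
by apply: val_inj; apply: turns_inj => //=; rewrite ?ph ?E1 ?E2 ?F1 ?F2 ?Ev1 ?Ev2.
Qed.

Lemma card_dyck_set_L2 n : #|dyck_set_L n 2| = \sum_(a < n.-1) #|two_at_set n a|.
Proof.
rewrite -sum1_card big_mkcond /=.
under [RHS]eq_bigr => a _ do rewrite -sum1_card big_mkcond.
rewrite exchange_big; apply: eq_bigr => p _ /=.
rewrite !inE; under [RHS]eq_bigr => a _ do rewrite inE.
case: (dyck_path p) => /=; last by rewrite big1.
rewrite /dyck_L.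
case: n p => [|n] p; first by rewrite big_geq // big_ord0.
rewrite big_add1 big_mkord; have := prod_eq2 (fun k : 'I_n =>
  'C(dyck_r p k.+1 + dyck_s p k.+1, dyck_r p k.+1)) => /= E.
transitivity (\prod_(k < n) 'C(dyck_r p k.+1 + dyck_s p k.+1, dyck_r p k.+1) == 2 : nat).
  by case: eqP.
rewrite E; apply: eq_bigr => a _; rewrite /two_at.
by case: forallP.
Qed.

(** Among the positions [a] of the marked letter, the first and the last one
leave an empty half, which contributes 0 when [n > 2]. *)
Lemma card_dyck_L2 n : 2 < n -> #|dyck_set_L n 2| = (n - 3) * motzkin (n - 4).
Proof.
case: n => [|[|[|m]]] // _; rewrite card_dyck_set_L2 /=.
have S a b : a + b = m.+1 -> #|two_at_set m.+3 a| = if (a == 0) || (b == 0) then 0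
    else motzkin m.-1.
  move=> ab; rewrite (@card_two_at_set _ a b); last by rewrite ab.
  case: a ab => [|a] ab; first by rewrite sum_chained0; case: b ab.
  case: b ab => [|b] ab.
    by under eq_bigr => h _ do rewrite mulnC; rewrite sum_chained0.
  by rewrite sum_chained ?motzkinE; [congr paths; lia | lia].
rewrite big_ord_recl (S 0 m.+1) // big_ord_recr /= (S m.+1 0) ?addn0 //= ?add0n.
rewrite (eq_bigr (fun _ => motzkin m.-1)); last first.
  move=> a _; have am := ltn_ord a; rewrite (S a.+1 (m - a)); last by lia.
  by rewrite subn_eq0 leqNgt am.
rewrite sum_nat_const card_ord; congr (_ * motzkin _); lia.
Qed.

Lemma card_dyck_L2_2 : #|dyck_set_L 2 2| = 1.
Proof.
by rewrite card_dyck_set_L2 big_ord1 (@card_two_at_set 2 0 0) // sum_chained0.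
Qed.

Lemma card_dyck_L2_small n : n < 2 -> #|dyck_set_L n 2| = 0.
Proof. by case: n => [|[|]] // _; rewrite card_dyck_set_L2 big_ord0. Qed.

(** * The generating function *)

Lemma fps_mul_monomial (R : pzSemiRingType) k (f : fps R) n :
  (fps_monomial R k * f)%fps n = if k <= n then f (n - k) else 0%R.
Proof.
rewrite /fps_mul /fps_monomial; case: leqP => kn.
  have kn' : k < n.+1 by [].
  rewrite (bigD1 (Ordinal kn')) //= eqxx GRing.mul1r big1 ?GRing.addr0 // => i ik.
  by rewrite (negPf (ik : (i : nat) != k)) GRing.mul0r.
rewrite big1 // => i _; have := ltn_ord i.
by case: eqP => [->|_ _]; [lia | rewrite GRing.mul0r].
Qed.

Theorem theorem4p1 :
  [/\ forall n : nat, 4 <= n ->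
        #|dyck_set_L n 2| = (n - 3) * motzkin (n - 4),
      #|dyck_set_L 2 2| = 1,
      #|dyck_set_L 3 2| = 0
    & dyck_L_gf 2 =1 ('X^2 + 'X^4 * ('X^1 * motzkin_gf)^`())%fps ].
Proof.
have card3 : #|dyck_set_L 3 2| = 0 by rewrite card_dyck_L2.
split=> //; first by move=> n n4; apply: card_dyck_L2; lia.
  exact: card_dyck_L2_2.
move=> n; rewrite /fps_add fps_mul_monomial /fps_monomial /dyck_L_gf.
case: (leqP 4 n) => n4.
  rewrite /fps_deriv fps_mul_monomial /= card_dyck_L2; last by lia.
  have -> : (n == 2) = false by lia.
  have -> : (0 < n) = true by lia.
  rewrite GRing.add0r /motzkin_gf mulnC GRing.natrM GRing.mulr_natr.
  by congr ((motzkin _)%:R *+ _)%R; lia.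
rewrite GRing.addr0; case: n n4 => [|[|[|[|n]]]] //= _.
- by rewrite card_dyck_L2_small.
- by rewrite card_dyck_L2_2.
- by rewrite card3.
Qed.
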